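(* Let $d\ge 2$ be an integer. There exist $n_0(d)$ and a constant $C_d>0$ such that for all $n\ge n_0(d)$ the following holds. Let $\mathcal{F}\subseteq\binom{[n]}{d+1}$ be such that for every $F\in\mathcal{F}$ there exists a subset $B_F\subseteq F$ with $|B_F|=1$ such that $F\cap F'\neq B_F$ for all $F'\in\mathcal{F}$. Then either $\mathcal{F}$ is a star (all members contain a common element) and $|\mathcal{F}|\le\binom{n-1}{d}$, or $|\mathcal{F}|\le\binom{n-1}{d}-C_d n^{d-1}$. In particular, $|\mathcal{F}|\le \binom{n-1}{d}$.
   Context: $\binom{[n]}{k}$ denotes the family of all $k$-element subsets of $[n]=\{1,\dots,n\}$. *)

(* Defs.v *)
From HB Require Import structures.
From mathcomp Require Import all_boot all_order all_algebra.
From mathcomp Require Import reals.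
Set Implicit Arguments. Unset Strict Implicit. Unset Printing Implicit Defensive.

Definition is_star (n : nat) (F : {set {set 'I_n}}) : Prop :=
  exists x : 'I_n, forall A, A \in F -> x \in A.

Definition singleton_avoiding (n : nat) (F : {set {set 'I_n}}) : Prop :=
  forall A, A \in F -> exists2 b : 'I_n, b \in A &
    forall A', A' \in F -> A :&: A' != [set b].

(* Main.v *)
(** Call [b] the mark of [A] when no member of [F] meets [A] exactly in [b].  If
no point [c <> b] lies in every member of [F] through [b], then the sets marked
[b] number at most [d^2 n^(d-2)]: such a set meets a fixed one in some
[c <> b], and also a member of [F] through [b] avoiding [c] in a third point.
So, up to [O(n^(d-1))] sets, every member of [F] contains a "heavy" point [b]
together with a point [col b <> b] forced by it.  Deleting the forced point from
a member leaves a [d]-set on whose heavy points [col] is constant, again up to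
[O(n^(d-1))] exceptions, and the deletion is injective on the unexceptional
members.  If there are many light points, or no colour class contains nearly all
points, a positive proportion of all [d]-sets is lost.

Otherwise some [x] is forced by nearly every point ("petals" of [x]), and the
members avoiding [x] live on the few remaining points.  If [e] points are marks
of members avoiding [x], there are at most [e d m^(d-1)] such members, [m] being
the number of remaining points, while for each such mark [b] all the sets
[{x, b}] plus [d-1] petals are missing from [F]; as [m] is a small fraction of
[n], the loss outweighs the gain by an amount of order [e n^(d-1)]. *)

Require Import Defs.
From HB Require Import structures.
From mathcomp Require Import all_boot all_order all_algebra.
From mathcomp Require Import reals.
From mathcomp Require Import zify.
Import Order.TTheory GRing.Theory Num.Theory.
Set Implicit Arguments.
Unset Strict Implicit.
Unset Printing Implicit Defensive.
Local Open Scope nat_scope.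

(** * Unions, powers, binomials and the arithmetic of the cases *)

Lemma leq_card_bigcup (I T : finType) (J : {set I}) (G : I -> {set T}) (M : nat) :
  (forall i, i \in J -> #|G i| <= M) -> #|\bigcup_(i in J) G i| <= #|J| * M.
Proof.
move=> leGM; rewrite -sum_nat_const.
elim/big_rec2: _ => [|i m A iJ leAm]; first by rewrite cards0.
by rewrite (leq_trans (leq_card_setU _ _)) ?leq_add ?leGM.
Qed.

Lemma leq_expr k m n : m <= n -> m ^ k <= n ^ k.
Proof. by case: k => // k lemn; rewrite leq_exp2r. Qed.

Lemma ffact_leq_exp n k : n ^_ k <= n ^ k.
Proof.
elim: k => // k IHk; rewrite ffactnSr expnSr.
by rewrite leq_mul ?leq_subr.
Qed.

Lemma bin_leq_exp n k : 'C(n, k) <= n ^ k.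
Proof.
apply: leq_trans (ffact_leq_exp n k).
by rewrite -bin_ffact leq_pmulr ?fact_gt0.
Qed.

Lemma exp_sub_leq_ffact n k : (n - k) ^ k <= n ^_ k.
Proof.
rewrite ffact_prod -[k in _ ^ k]card_ord -prod_nat_const.
by apply: leq_prod => i _; rewrite leq_sub2l // ltnW.
Qed.

(** From [2 * k <= m] follows [n <= 2 * a * (m - k)], and [(m - k) ^ k] is at most the falling
    factorial. *)
Lemma exp_leq_bin a n m k : n <= a * m -> 2 * k <= m ->
  n ^ k <= (2 * a) ^ k * k`! * 'C(m, k).
Proof.
move=> le_n_am le_2k_m.
rewrite -mulnA [_`! * _]mulnC bin_ffact.
apply: leq_trans (leq_mul (leqnn _) (exp_sub_leq_ffact m k)).
by rewrite -expnMn leq_expr //; nia.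
Qed.

Lemma leq_double_divn q n : 0 < q -> q <= n -> n <= 2 * q * (n %/ q).
Proof.
move=> q_gt0 le_qn; rewrite mulnAC.
apply: leq_trans (ltnW (ltn_ceil n q_gt0)) _; rewrite leq_mul2r.
by have : 0 < n %/ q; [rewrite divn_gt0 | lia].
Qed.

Lemma leq_double_of_few q h l n : 16 <= q -> h + l = n -> q * l < n -> n <= 2 * h.
Proof. by move=> q_ge; have := leq_mul q_ge (leqnn l); lia. Qed.

(** Here [h] counts heavy points, [l] light ones, [p] the petals of one centre and [c] the heavy
    points of other colours. *)
Lemma leq_other_petals q h l n p c : h + l = n -> p + c = h -> q * l < n ->
  q * p + 2 * n <= q * n -> n <= q * c.
Proof. by move=> <- <-; lia. Qed.

Lemma leq_double_of_large q n h : 16 <= q -> q * n < q * h + 2 * n -> n <= 2 * h.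
Proof.
move=> q_ge large; rewrite leqNgt; apply/negP => lt_hn.
by have := leq_mul q_ge (ltnW lt_hn); have := leq_mul (leqnn q) lt_hn; nia.
Qed.

Lemma leq_of_large_petals f n h r : r + h.+1 = n ->
  16 * f * n < 16 * f * h + 2 * n -> 4 * (2 * f) * r <= n.
Proof. by move=> <-; nia. Qed.

Lemma leq_gain e f c b g k n : 0 < e -> f + e * c <= b + e * g -> 2 * g <= c ->
  n <= k * c -> 2 * k * f + n <= 2 * k * b.
Proof.
move=> e_gt0 le_f le_g le_n.
have le_eg : 2 * (e * g) <= e * c by rewrite mulnCA leq_mul2l le_g orbT.
have le_c : c <= e * c by rewrite leq_pmull.
have : 2 * f + c <= 2 * b by lia.
by move/(leq_mul (leqnn k)); lia.
Qed.

(** * Sets of given size between two sets *)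

Section Counting.
Variable T : finType.
Implicit Types S U A : {set T}.

Definition between S U k :=
  [set A : {set T} | [&& S \subset A, A \subset U & #|A| == k]].

Lemma card_between S U k : S \subset U -> #|S| <= k ->
  #|between S U k| = 'C(#|U| - #|S|, k - #|S|).
Proof.
move=> sSU leSk; rewrite -(cardsDS sSU) -cards_draws.
pose f A := S :|: A.
rewrite -[RHS](card_in_imset (f := f)); last first.
  move=> A B; rewrite !inE !subsetD => /andP[/andP[_ dA] _] /andP[/andP[_ dB] _] eqf.
  have fK (X : {set T}) : [disjoint X & S] -> f X :\: S = X.
    by move=> dX; rewrite setDUl setDv set0U; apply/setDidPl.
  by rewrite -(fK A) // -(fK B) // eqf.
congr #|pred_of_set _|; apply/setP=> A; rewrite !inE; apply/and3P/imsetP.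
  case=> sSA sAU /eqP cA; exists (A :\: S).
    by rewrite !inE setSD //= cardsDS // cA.
  by rewrite /f -{1}(setID A S) (setIidPr sSA).
case=> B; rewrite !inE subsetD => /andP[/andP[sBU dB] /eqP cB] ->.
rewrite subsetUl subUset sSU sBU; split=> //.
rewrite cardsU disjoint_setI0 1?disjoint_sym // cards0 cB; lia.
Qed.

Lemma card_between_leq S U k : #|between S U k| <= #|U| ^ (k - #|S|).
Proof.
have [/andP[sSU leSk]|] := boolP ((S \subset U) && (#|S| <= k)).
  rewrite card_between // (leq_trans (bin_leq_exp _ _)) //.
  by rewrite leq_expr // leq_subr.
move=> nSU; rewrite (_ : between S U k = set0) ?cards0 //.
apply/setP=> A; rewrite !inE; apply/negbTE/and3P=> -[sSA sAU /eqP cA].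
by case/negP: nSU; rewrite (subset_trans sSA) //= -cA subset_leq_card.
Qed.

Lemma card_ksets k : #|[set A : {set T} | #|A| == k]| = 'C(#|T|, k).
Proof. exact: card_draws. Qed.

End Counting.

(** * Marks and forced points *)

Section Structure.
Variables (T : finType) (d : nat) (F : {set {set T}}).
Hypothesis sizeF : forall A, A \in F -> #|A| = d.+1.
Implicit Types (b c e x : T) (A B R U : {set T}).

Definition marked b :=
  [set A in F | (b \in A) && [forall A' in F, A :&: A' != [set b]]].

(** A point in no member of [F] vacuously forces every other point. *)
Definition forces b c := (c != b) && [forall A in F, (b \in A) ==> (c \in A)].

(* [col b = b] is the junk value for a point that forces nothing. *)
Definition col b := odflt b [pick c | forces b c].

Definition heavy := [set b | col b != b].

Lemma col_mem A b : A \in F -> b \in A -> col b \in A.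
Proof.
move=> AF bA; rewrite /col; case: pickP => //= c /andP[_ /forall_inP/(_ A AF)].
by rewrite bA.
Qed.

Lemma light_avoid b c : b \notin heavy -> c != b ->
  exists2 A, A \in F & (b \in A) && (c \notin A).
Proof.
rewrite inE negbK /col => + cNb; case: pickP => [e /andP[/negPf-> //]|/(_ c)] /=.
rewrite /forces cNb => /= /negbT; rewrite negb_forall_in => /exists_inP[A AF].
by rewrite negb_imply => bA _; exists A.
Qed.

Lemma marked_meet A A' b : A \in marked b -> A' \in F -> b \in A' ->
  exists2 e, e \in A & e \in A' :\ b.
Proof.
rewrite inE => /and3P[_ bA /forall_inP dA] A'F bA'; have := dA _ A'F.
case: (set_0Vmem ((A :&: A') :\ b)) => [e0|[e]].
  have bAA : b \in A :&: A' by rewrite inE bA.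
  by rewrite -(setD1K bAA) e0 setU0 eqxx.
by rewrite !inE => /and3P[eb eA eA'] _; exists e; rewrite // !inE eb.
Qed.

Lemma card_marked_light b : b \notin heavy ->
  #|marked b| <= d * (d * #|T| ^ (d - 2)).
Proof.
move=> lb; have [->|[A0 A0b]] := set_0Vmem (marked b); first by rewrite cards0.
have [A0F bA0] : A0 \in F /\ b \in A0 by move: A0b; rewrite inE => /and3P[].
pose W c := odflt set0 [pick A in F | (b \in A) && (c \notin A)].
have WP c : c != b -> [/\ W c \in F, b \in W c & c \notin W c].
  rewrite /W => cb; case: pickP => [A /and3P[] //|none].
  by have [A AF Abc] := light_avoid lb cb; have := none A; rewrite AF Abc.
have cardD1 A : A \in F -> b \in A -> #|A :\ b| = d.
  by move=> /sizeF cA bA; have := cardsD1 b A; rewrite cA bA => -[].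
have sub : marked b \subset
  \bigcup_(c in A0 :\ b) \bigcup_(e in W c :\ b) between [set b; c; e] setT d.+1.
  apply/subsetP=> A Ab; move: (Ab); rewrite inE => /and3P[AF bA _].
  have [c cA cA0] := marked_meet Ab A0F bA0; have cb : c != b by case/setD1P: cA0.
  have [WF bW cW] := WP _ cb; have [e eA eW] := marked_meet Ab WF bW.
  apply/bigcupP; exists c => //; apply/bigcupP; exists e => //.
  rewrite inE subsetT sizeF // eqxx !andbT; apply/subsetP=> z.
  by rewrite !inE => /orP[/orP[]|] /eqP->.
apply: leq_trans (subset_leq_card sub) _.
apply: leq_trans (leq_card_bigcup (M := d * #|T| ^ (d - 2)) _) _; last first.
  by rewrite cardD1.
move=> c /setD1P[cb _]; have [WF bW cW] := WP _ cb.
apply: leq_trans (leq_card_bigcup (M := #|T| ^ (d - 2)) _) _; last first.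
  by rewrite cardD1.
move=> e /setD1P[eb eW]; apply: leq_trans (card_between_leq _ _ _) _.
(* Thus [b], [c], [e] are distinct, which leaves [d - 2] free points. *)
have ce : e != c by apply: contraNneq cW => {1}<-.
by rewrite cardsT setUC cardsU1 cards2 !inE (negPf eb) (negPf ce) eq_sym cb subSS.
Qed.

(** * Deleting forced points *)

Definition mono := [set R : {set T} | (#|R| == d) &&
  [exists b in R :&: heavy, forall b' in R :&: heavy, col b' == col b]].

Definition touch := [set A in F | A :&: heavy != set0].

(** Undoes the deletion: on a set in [mono], [col] takes a single value on the heavy points. *)
Definition refill R := R :|: col @: (R :&: heavy).

(** All ways to restore two deleted forced points. Colours of colours are included because the point
    forcing one of them may be the other. *)
Definition cands U := [set U :|: [set p.1; p.2] | p in
  let V := col @: (U :|: col @: U) in setX V V].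

(* [A] is recovered from [A] minus its forced point when [col] is constant on the
   heavy points left, and up to boundedly many choices from [A] minus two forced
   points otherwise. *)
Lemma touch_sub : 0 < d -> touch \subset refill @: mono :|:
  \bigcup_(U in [set U : {set T} | #|U| == d.-1]) cands U.
Proof.
move=> d_gt0; apply/subsetP=> A; rewrite inE => /andP[AF /set0Pn[b /setIP[bA hb]]].
have cbA := col_mem AF bA; have cb : col b != b by move: hb; rewrite inE.
have cA := sizeF AF; rewrite inE.
have c1 : #|A :\ col b| = d by have := cardsD1 (col b) A; rewrite cA cbA => -[].
have [/forall_inP mA|] :=
    boolP [forall b' in (A :\ col b) :&: heavy, col b' == col b].
  apply/orP; left; apply/imsetP; exists (A :\ col b).
    rewrite inE c1 eqxx /=; apply/exists_inP; exists b; last exact/forall_inP.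
    by rewrite !inE eq_sym cb bA /=; move: hb; rewrite inE.
  rewrite /refill (_ : col @: _ = [set col b]) ?[_ :|: [set _]]setUC ?setD1K //.
  apply/setP=> z; rewrite inE; apply/imsetP/eqP=> [[b' /mA/eqP->] //|->].
  by exists b => //; rewrite 2!inE hb !inE eq_sym cb bA.
rewrite negb_forall_in => /exists_inP[b' /setIP[/setD1P[b'cb b'A] hb'] cb'].
apply/orP; right; have cb'A := col_mem AF b'A.
pose U := A :\ col b :\ col b'.
have cU : #|U| = d.-1.
  by rewrite -c1 (cardsD1 (col b') (A :\ col b)) !inE cb' cb'A.
apply/bigcupP; exists U; first by rewrite inE cU.
have b'U : b' \in U.
  by rewrite !inE b'cb b'A eq_sym; move: hb'; rewrite inE => ->.
apply/imsetP; exists (col b', col b) => /=.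
  rewrite inE /=; apply/andP; split; apply: imset_f.
    by rewrite inE b'U.
  have [->|bcb'] := eqVneq b (col b'); first by rewrite inE imset_f ?orbT.
  by rewrite !inE bcb' eq_sym cb bA.
apply/setP=> z; rewrite !inE.
by case: eqVneq => [->|_]; case: eqVneq => [->|_] //=; rewrite ?orbT ?orbF.
Qed.

Lemma card_cands U : #|cands U| <= 4 * #|U| ^ 2.
Proof.
apply: leq_trans (leq_imset_card _ _) _; rewrite cardsX.
set V := imset _ _; suff: #|V| <= 2 * #|U| by move=> ?; nia.
apply: leq_trans (leq_imset_card _ _) _.
apply: leq_trans (leq_card_setU _ _) _.
by rewrite mul2n -addnn leq_add2l leq_imset_card.
Qed.

Hypothesis d_ge2 : 1 < d.
Hypothesis F_marked : forall A, A \in F -> exists b, A \in marked b.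

(** The factor 5 is 1 + 4: one part for the light marks, four for the candidates of the sets [U]. *)
Lemma card_F_mono : #|F| <= #|mono| + 5 * d ^ 2 * #|T| ^ d.-1.
Proof.
set L := \bigcup_(b in ~: heavy) marked b.
have sF : F \subset L :|: touch.
  apply/subsetP=> A AF; rewrite !inE AF /=; have [b Ab] := F_marked AF.
  have bA : b \in A by move: Ab; rewrite inE => /and3P[].
  have [hb|lb] := boolP (b \in heavy).
    by apply/orP; right; apply/set0Pn; exists b; rewrite inE bA.
  by apply/orP; left; apply/bigcupP; exists b; rewrite // inE.
have cL : #|L| <= d ^ 2 * #|T| ^ d.-1.
  apply: leq_trans (leq_card_bigcup (M := d * (d * #|T| ^ (d - 2))) _) _.
    by move=> b; rewrite inE; apply: card_marked_light.
  have -> : d.-1 = (d - 2).+1 by lia.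
  rewrite (expnS #|T|) [leqLHS](_ : _ = #|~: heavy| * (d ^ 2 * #|T| ^ (d - 2))).
    by rewrite mulnCA !leq_mul ?max_card.
  by rewrite -mulnn -mulnA.
have ct : #|touch| <= #|mono| + #|T| ^ d.-1 * (4 * d ^ 2).
  apply: leq_trans (subset_leq_card (touch_sub (ltnW d_ge2))) _.
  apply: leq_trans (leq_card_setU _ _) _; apply: leq_add (leq_imset_card _ _) _.
  apply: leq_trans (leq_mul (bin_leq_exp _ _) (leqnn _)); rewrite -card_ksets.
  apply: leq_card_bigcup => U; rewrite inE => /eqP cU.
  by apply: leq_trans (card_cands _) _; rewrite cU leq_mul2l leq_expr // leq_pred.
have := leq_trans (subset_leq_card sF) (leq_card_setU _ _).
lia.
Qed.

(** * Lost [d]-sets *)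

Lemma card_mono_disjoint (M : {set {set T}}) :
  (forall R, R \in M -> #|R| = d) -> [disjoint mono & M] ->
  #|mono| + #|M| <= 'C(#|T|, d).
Proof.
move=> sizeM; rewrite -(leq_card_setU mono M).2 => /eqP <-; rewrite -card_ksets.
apply/subset_leq_card/subsetP=> R; rewrite !inE => /orP[/andP[] //|/sizeM/eqP //].
Qed.

Lemma card_mono_light : #|mono| + 'C(#|~: heavy|, d) <= 'C(#|T|, d).
Proof.
rewrite -cards_draws; apply: card_mono_disjoint.
  by move=> R; rewrite inE => /andP[_ /eqP].
rewrite disjoint_sym disjoint_subset; apply/subsetP=> R; rewrite !inE.
case/andP=> sR _; rewrite negb_and negb_exists_in; apply/orP; right.
by apply/forall_inP=> b /setIP[/(subsetP sR)]; rewrite inE => /negPf->.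
Qed.

Definition mixed := [set R : {set T} | (#|R| == d) &&
  [exists b in R :&: heavy, exists b' in R :&: heavy, col b != col b']].

Lemma card_mono_mixed : #|mono| + #|mixed| <= 'C(#|T|, d).
Proof.
apply: card_mono_disjoint; first by move=> R; rewrite inE => /andP[/eqP].
rewrite disjoint_subset; apply/subsetP=> R; rewrite !inE.
case/andP=> -> /exists_inP[b0 _ /forall_inP mR] /=.
rewrite negb_exists_in; apply/forall_inP=> b Rb; rewrite negb_exists_in.
by apply/forall_inP=> b' Rb'; rewrite (eqP (mR _ Rb)) (eqP (mR _ Rb')) eqxx.
Qed.

(** Double counting of pairs of heavy points with different colours: each lies in
    ['C(#|T| - 2, d - 2)] sets of size [d], and each set holds at most [d ^ 2] pairs. *)
Lemma card_mixed_geq m :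
  (forall b, b \in heavy -> m <= #|[set b' in heavy | col b != col b']|) ->
  #|heavy| * (m * 'C(#|T| - 2, d - 2)) <= #|mixed| * d ^ 2.
Proof.
move=> le_m; rewrite -sum_nat_const.
pose P b b' := (b' \in heavy) && (col b != col b').
apply: (@leq_trans (\sum_(b in heavy) \sum_(b' | P b b')
  #|between [set b; b'] setT d|)).
  apply: leq_sum => b hb; rewrite (eq_bigr (fun=> 'C(#|T| - 2, d - 2))).
    by rewrite sum_nat_cond_const leq_mul2r le_m ?orbT.
  move=> b' /andP[_ cbb']; have bb' : b != b' by apply: contraNneq cbb' => ->.
  by rewrite card_between ?subsetT // cards2 bb' // cardsT.
rewrite pair_big_dep /=.
under eq_bigr do rewrite -sum1_card.
rewrite (exchange_big_dep (mem mixed)) /=; last first.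
  move=> [b b'] R /= /andP[hb /andP[hb' cbb']]; rewrite !inE subUset !sub1set.
  case/and3P=> /andP[bR b'R] _ ->.
  apply/exists_inP; exists b; first by rewrite inE bR.
  by apply/exists_inP; exists b'; first by rewrite inE b'R.
rewrite -sum_nat_const; apply: leq_sum => R; rewrite inE => /andP[/eqP cR _].
rewrite sum1dep_card -cR -mulnn -cardsX; apply/subset_leq_card/subsetP=> -[b b'].
by rewrite !inE subUset !sub1set /= => /andP[_ /and3P[]].
Qed.

(** * Members through and off a centre *)

Section Centre.
Variable x : T.

(** Heaviness keeps out [x] itself, whose junk colour may be [x]. *)
Definition petals := [set b in heavy | col b == x].
Definition rest := ~: (x |: petals).
Definition escaping := [set b | [exists A in marked b, x \notin A]].

(** A petal in [A] would force [x] into [A]. *)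
Lemma sub_rest A : A \in F -> x \notin A -> A \subset rest.
Proof.
move=> AF xA; apply/subsetP=> b bA; rewrite !inE negb_or.
rewrite (contraTneq _ bA) => [|->//] /=; rewrite negb_and orbC.
by rewrite (contraNneq _ xA) // => <-; apply: col_mem.
Qed.

(** For a fixed member [A0] marked [b] and avoiding [x], every other one meets [A0] in one of [d]
    further points; the remaining [d.-1] points lie in [rest]. *)
Lemma card_avoiding :
  #|[set A in F | x \notin A]| <= #|escaping| * (d * #|rest| ^ d.-1).
Proof.
apply: leq_trans (leq_card_bigcup
  (G := fun b => [set A in marked b | x \notin A]) _).
  apply/subset_leq_card/subsetP=> A; rewrite inE => /andP[AF xA].
  have [b Ab] := F_marked AF; apply/bigcupP; exists b; last by rewrite inE Ab.
  by rewrite inE; apply/exists_inP; exists A.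
move=> b; rewrite inE => /exists_inP[A0 A0b xA0].
have [A0F bA0] : A0 \in F /\ b \in A0 by move: A0b; rewrite inE => /and3P[].
have cD1 : #|A0 :\ b| = d by have := cardsD1 b A0; rewrite sizeF // bA0 => -[].
rewrite -{1}cD1; apply: leq_trans (leq_card_bigcup
  (G := fun c => between [set b; c] rest d.+1) _).
  apply/subset_leq_card/subsetP=> A; rewrite inE => /andP[Ab xA].
  move: (Ab); rewrite inE => /and3P[AF bA _].
  have [c cA cA0] := marked_meet Ab A0F bA0; apply/bigcupP; exists c => //.
  by rewrite inE sub_rest // sizeF // eqxx subUset !sub1set bA cA.
move=> c /setD1P[cb _]; apply: leq_trans (card_between_leq _ _ _) _.
by rewrite cards2 eq_sym cb subSS subn1.
Qed.

Lemma escaping_rest : escaping \subset rest.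
Proof.
apply/subsetP=> b; rewrite inE => /exists_inP[A + xA].
by rewrite inE => /and3P[AF bA _]; apply: (subsetP (sub_rest AF xA)).
Qed.

(** A set made of [x], an escaping [b] and [d.-1] petals meets [rest] only in [b]. It therefore
    meets a member marked [b] and avoiding [x] exactly in [b], so it is not in [F]. *)
Lemma card_through :
  #|[set A in F | x \in A]| + #|escaping| * 'C(#|petals|, d.-1) <= 'C(#|T|.-1, d).
Proof.
pose f (p : T * {set T}) := [set x; p.1] :|: p.2.
pose Q := setX escaping [set R : {set T} | R \subset petals & #|R| == d.-1].
have xpet : x \notin petals by rewrite !inE; case: eqVneq.
have capf p : p \in Q -> f p :&: rest = [set p.1].
  case: p => b R; rewrite !inE /= => /andP[eb /andP[/subsetP sR _]].
  have eb' : b \in escaping by rewrite inE.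
  have rb := subsetP escaping_rest _ eb'.
  apply/setP=> z; rewrite in_setI in_set1 /f /= in_setU in_set2.
  apply/andP/eqP=> [[]|->]; last by rewrite rb eqxx orbT.
  rewrite in_setC in_setU1 negb_or => + /andP[zx zpet].
  by rewrite (negPf zx) /= => /orP[/eqP //|/sR]; rewrite (negPf zpet).
have finj : {in Q &, injective f}.
  move=> p q pQ qQ efpq.
  have e1 : p.1 = q.1 by apply/set1P; rewrite -capf // -efpq capf // set11.
  have capD r : r \in Q -> f r :&: petals = r.2.
    case: r => b R; rewrite !inE /= => /andP[eb /andP[/subsetP sR _]].
    have eb' : b \in escaping by rewrite inE.
    have := subsetP escaping_rest _ eb'; rewrite in_setC in_setU1 negb_or.
    case/andP=> bx bpet; apply/setP=> z; rewrite in_setI /f /= in_setU in_set2.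
    apply/andP/idP=> [[+ zD]|zR]; last by rewrite zR orbT sR.
    case/orP=> // /orP[] /eqP ez; first by rewrite -ez zD in xpet.
    by rewrite -ez zD in bpet.
  have e2 : p.2 = q.2 by rewrite -(capD p) // -(capD q) // efpq.
  by move: p q e1 e2 {pQ qQ efpq} => [? ?] [? ?] /= -> ->.
have dis : [disjoint [set A in F | x \in A] & f @: Q].
  rewrite disjoint_sym disjoint_subset; apply/subsetP=> A /imsetP[p pQ ->].
  rewrite !inE /=; apply/negP=> /andP[fF _].
  have: p.1 \in escaping by move: pQ; case: p {fF} => b R; rewrite inE => /andP[].
  rewrite inE => /exists_inP[G]; rewrite inE => /and3P[GF bG /forall_inP dG] xG.
  case/negP: (dG _ fF); rewrite -(setIidPl (sub_rest GF xG)) -setIA.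
  by rewrite [rest :&: _]setIC capf //; apply/eqP/setIidPr; rewrite sub1set.
have <- : #|f @: Q| = #|escaping| * 'C(#|petals|, d.-1).
  by rewrite card_in_imset // cardsX cards_draws.
move: dis; rewrite -(leq_card_setU _ _).2 => /eqP <-.
have <- : #|between [set x] setT d.+1| = 'C(#|T|.-1, d).
  by rewrite card_between ?subsetT ?cards1 // cardsT !subn1.
apply/subset_leq_card/subsetP=> A; rewrite !inE subsetT sub1set.
case/orP=> [/andP[AF ->]|/imsetP[[b R] bRQ ->]]; first by rewrite sizeF //=.
rewrite /f /= !inE eqxx /=; move: bRQ; rewrite inE => /andP[/= eb].
rewrite inE => /andP[sR /eqP cR].
have := subsetP escaping_rest b eb; rewrite !in_setC in_setU1 negb_or => /andP[bx bpet].
rewrite cardsU (_ : _ :&: R = set0) ?cards0.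
  by rewrite cards2 [x == b]eq_sym bx cR; lia.
apply/setP=> z; rewrite in_setI in_set2 in_set0; apply/negP=> /andP[+ /(subsetP sR) zD].
by case/orP=> /eqP ez; [move: xpet|move: bpet]; rewrite -ez zD.
Qed.

Lemma card_F_center :
  #|F| + #|escaping| * 'C(#|petals|, d.-1) <=
    'C(#|T|.-1, d) + #|escaping| * (d * #|rest| ^ d.-1).
Proof.
have cF : #|F| = #|[set A in F | x \in A]| + #|[set A in F | x \notin A]|.
  rewrite -(cardsID [set A : {set T} | x \in A] F).
  by congr (_ + _); apply: eq_card => A; rewrite !inE // andbC.
by have := card_through; have := card_avoiding; lia.
Qed.

Lemma card_rest : #|rest| + #|petals|.+1 = #|T|.
Proof.
by rewrite -(cardsC (x |: petals)) cardsU1 !inE addnC; case: eqVneq.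
Qed.

Lemma escaping_gt0 A : A \in F -> x \notin A -> 0 < #|escaping|.
Proof.
move=> AF xA; have [b Ab] := F_marked AF; apply/card_gt0P; exists b.
by rewrite inE; apply/exists_inP; exists A.
Qed.

End Centre.

(** * The three cases and their combination *)

Lemma card_F_loss a loss : 0 < a -> 0 < #|T| -> #|mono| + loss <= 'C(#|T|, d) ->
  #|T| ^ d <= a * loss -> a * (5 * d ^ 2 + 2) <= #|T| ->
  #|F| + #|T| ^ d.-1 <= 'C(#|T|.-1, d).
Proof.
move=> a_gt0 n_gt0 le_loss le_n le_a.
have d_gt0 := ltnW d_ge2.
have le_bin : 'C(#|T|, d) <= 'C(#|T|.-1, d) + #|T| ^ d.-1.
  rewrite -{1}(prednK n_gt0) -{1}(prednK d_gt0) binS prednK // leq_add2l.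
  by rewrite (leq_trans (bin_leq_exp _ _)) // leq_expr // leq_pred.
(* Of these multiples of [#|T| ^ d.-1], [5 * d ^ 2] pay for [card_F_mono], one for Pascal's rule,
   and one is the surplus claimed. *)
have le_loss2 : (5 * d ^ 2 + 2) * #|T| ^ d.-1 <= loss.
  rewrite -(leq_pmul2l a_gt0) (leq_trans _ le_n) // mulnA.
  by rewrite [leqRHS](_ : _ = #|T| * #|T| ^ d.-1) ?leq_mul // -expnS prednK.
move: card_F_mono le_loss le_bin le_loss2; move: (#|T| ^ _) (5 * d ^ 2) => N c.
by rewrite mulnDl; lia.
Qed.

(* [1/q] is the proportion of points below which a set of points counts as small;
   [k1], [k2], [k3] are the inverse densities of the losses in the three cases. *)
Let q := 16 * d`!.
Let n1 := 2 * d * q + 8 * d.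
Let k1 := (2 * q) ^ d * d`!.
Let k2 := 4 * q * d ^ 2 * ((2 * 2) ^ (d - 2) * (d - 2)`!).
Let k3 := (2 * 2) ^ d.-1 * d.-1`!.

Let q_ge16 : 16 <= q.
Proof. by rewrite leq_pmulr ?fact_gt0. Qed.

Hypothesis n_ge : n1 + (k1 + k2) * (5 * d ^ 2 + 2) <= #|T|.

Let n_ge1 : n1 <= #|T|.
Proof. by apply: leq_trans n_ge; rewrite leq_addr. Qed.

Let n_ge8d : 8 * d <= #|T|.
Proof. by apply: leq_trans n_ge1; rewrite leq_addl. Qed.

Let n_geq : q <= #|T|.
Proof.
apply: leq_trans n_ge1; apply: leq_trans (leq_addr _ _).
by rewrite leq_pmull // muln_gt0 (ltnW d_ge2).
Qed.

Let n_gt0 : 0 < #|T|.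
Proof. by apply: leq_trans n_ge8d; rewrite muln_gt0 (ltnW d_ge2). Qed.

Lemma stability_many_light : #|T| <= q * #|~: heavy| ->
  #|F| + #|T| ^ d.-1 <= 'C(#|T|.-1, d).
Proof.
move=> le_q; apply: (card_F_loss (a := k1)) card_mono_light _ _ => //.
- by rewrite muln_gt0 expn_gt0 fact_gt0 muln_gt0 (ltn_trans _ q_ge16).
- apply: exp_leq_bin => //; rewrite -(leq_pmul2l (ltn_trans (isT : 0 < 15) q_ge16)).
  by apply: leq_trans le_q; apply: leq_trans n_ge1; rewrite /n1; nia.
- by apply: leq_trans n_ge; rewrite mulnDl; lia.
Qed.

(** Fewer than n/q points are light and each colour class misses at least 2n/q points, so every
    heavy point has at least n/q heavy points of other colours. *)
Lemma stability_small_petals : q * #|~: heavy| < #|T| ->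
  (forall x, q * #|petals x| + 2 * #|T| <= q * #|T|) ->
  #|F| + #|T| ^ d.-1 <= 'C(#|T|.-1, d).
Proof.
move=> lt_q small; have q_gt0 : 0 < q := ltn_trans (isT : 0 < 15) q_ge16.
have cH : #|heavy| + #|~: heavy| = #|T| by rewrite cardsC.
have n_d := n_ge8d.
have H2 := leq_double_of_few q_ge16 cH lt_q.
pose m := #|T| %/ q.
have m_leq : q * m <= #|T| by rewrite mulnC leq_trunc_div.
have m_geq : #|T| <= 2 * q * m := leq_double_divn q_gt0 n_geq.
have le_mixed := @card_mixed_geq m.
apply: (card_F_loss (a := k2)) card_mono_mixed _ _ => //.
- by rewrite !muln_gt0 ?expn_gt0 ?fact_gt0 (ltnW d_ge2).
- have {}le_mixed : #|heavy| * (m * 'C(#|T| - 2, d - 2)) <= #|mixed| * d ^ 2.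
    apply: le_mixed => b hb; rewrite -(leq_pmul2l q_gt0); apply: leq_trans m_leq _.
    have cp : #|petals (col b)| + #|[set b' in heavy | col b != col b']| = #|heavy|.
      rewrite -(cardsID (petals (col b)) heavy); congr (_ + _).
        by apply: eq_card => b'; rewrite !inE andbA andbb.
      apply: eq_card => b'; rewrite !inE [col b == _]eq_sym.
      by case: (col b' == b'); case: (col b' == col b).
    exact: leq_other_petals cH cp lt_q (small _).
  have le_bin : #|T| ^ (d - 2) <= (2 * 2) ^ (d - 2) * (d - 2)`! * 'C(#|T| - 2, d - 2).
    by apply: exp_leq_bin; clear -n_d d_ge2; lia.
  rewrite -{1}(subnK d_ge2) expnD /k2.
  move: (_ ^ (d - 2) * _`!) le_bin le_mixed => z.
  move: 'C(_, _) => y le_bin le_mixed.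
  have le_sq : #|T| ^ 2 <= 4 * q * (#|heavy| * m).
    rewrite -mulnn [leqRHS](_ : _ = 2 * #|heavy| * (2 * q * m)) ?leq_mul //; lia.
  apply: leq_trans (leq_mul le_bin le_sq) _.
  have := leq_mul (leqnn (4 * q * z)) le_mixed; move: (d ^ 2); lia.
- by apply: leq_trans n_ge; rewrite mulnDl; lia.
Qed.

Lemma stability_large_petals x : q * #|T| < q * #|petals x| + 2 * #|T| ->
  (exists2 A, A \in F & x \notin A) ->
  2 * k3 * #|F| + #|T| ^ d.-1 <= 2 * k3 * 'C(#|T|.-1, d).
Proof.
move=> large [A AF xA]; have esc_gt0 := escaping_gt0 AF xA.
have cR := card_rest x; have cF := card_F_center x.
have n_d := n_ge8d.
have le_rest : 4 * (2 * d`!) * #|rest x| <= #|T| by apply: leq_of_large_petals cR large.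
have le_pet := leq_double_of_large q_ge16 large.
have le_bin : #|T| ^ d.-1 <= k3 * 'C(#|petals x|, d.-1).
  by apply: exp_leq_bin => //; clear -n_d le_pet; lia.
have k3_gt0 : 0 < k3 by rewrite muln_gt0 expn_gt0 fact_gt0.
(* As [rest] has at most n/(8 d!) points, the ratio to be checked reduces to (2 d!)^(d-1) >= 2 d! =
   2d (d-1)!, true since d - 1 >= 1. This is why [q] contains d!. *)
have le_esc : 2 * (d * #|rest x| ^ d.-1) <= 'C(#|petals x|, d.-1).
  rewrite -(leq_pmul2l k3_gt0) (leq_trans _ le_bin) //.
  apply: leq_trans (leq_expr d.-1 le_rest).
  rewrite !expnMn /k3 !mulnA leq_mul2r -!mulnA leq_mul2l; apply/orP; right.
  apply/orP; right; rewrite -expnMn.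
  have -> : d.-1`! * (2 * d) = 2 * d`!.
    by rewrite -{3}(prednK (ltnW d_ge2)) factS prednK ?(ltnW d_ge2) //; lia.
  by rewrite -{1}[2 * d`!]expn1 leq_pexp2l ?muln_gt0 ?fact_gt0 // -ltnS prednK // ltnW.
exact: leq_gain esc_gt0 cF le_esc le_bin.
Qed.

Lemma stability : (exists x, forall A, A \in F -> x \in A) \/
  2 * k3 * #|F| + #|T| ^ d.-1 <= 2 * k3 * 'C(#|T|.-1, d).
Proof.
have k3_gt0 : 0 < k3 by rewrite muln_gt0 expn_gt0 fact_gt0.
(* Only the case of large petals pays the factor [2 * k3]; the other two lose more. *)
have weaken : #|F| + #|T| ^ d.-1 <= 'C(#|T|.-1, d) ->
    2 * k3 * #|F| + #|T| ^ d.-1 <= 2 * k3 * 'C(#|T|.-1, d).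
  move=> /(leq_mul (leqnn (2 * k3))); apply: leq_trans.
  by rewrite mulnDr leq_add2l leq_pmull // muln_gt0.
have [le_q|lt_q] := leqP #|T| (q * #|~: heavy|).
  by right; apply/weaken/stability_many_light.
have [/forallP small|] :=
    boolP [forall x, q * #|petals x| + 2 * #|T| <= q * #|T|].
  by right; apply/weaken/stability_small_petals.
rewrite negb_forall => /existsP[x]; rewrite -ltnNge => large.
have [/forall_inP star|] := boolP [forall A in F, x \in A]; first by left; exists x.
by rewrite negb_forall_in => /exists_inP nstar; right; apply: stability_large_petals nstar.
Qed.

End Structure.

(** * Stars and the theorem on [n] *)

Lemma card_star n d (F : {set {set 'I_n}}) :
  (forall A, A \in F -> #|A| = d.+1) -> is_star F -> #|F| <= 'C(n.-1, d).
Proof.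
move=> sizeF [x starF]; have := @card_between _ [set x] setT d.+1.
rewrite subsetT cards1 cardsT card_ord !subn1 => <- //.
apply/subset_leq_card/subsetP=> A AF.
by rewrite inE sub1set starF // subsetT sizeF /=.
Qed.

Unset Implicit Arguments.
Local Open Scope ring_scope.

Theorem theorem5p2 (R : realType) (d : nat) (hd : (2 <= d)%N) :
  exists (n0 : nat) (C : R), 0 < C /\
  forall (n : nat), (n0 <= n)%N ->
  forall F : {set {set 'I_n}},
    (forall A, A \in F -> #|A| = d.+1) ->
    singleton_avoiding F ->
    (is_star F /\ (#|F| <= 'C(n.-1, d))%N) \/
    (#|F|%:R : R) <= ('C(n.-1, d))%:R - C * (n%:R) ^+ d.-1.
Proof.
(* [C] is the inverse of [2 * k3]; [n0] stays open until [stability] is applied and fixes it as its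
   threshold. *)
eexists; exists ((2 * ((2 * 2) ^ d.-1 * d.-1`!))%N%:R^-1).
have K_gt0 : (0 < 2 * ((2 * 2) ^ d.-1 * d.-1`!))%N.
  by rewrite !muln_gt0 expn_gt0 fact_gt0.
split; first by rewrite invr_gt0 ltr0n.
move=> n le_n F sizeF avoidF; rewrite -{1}(card_ord n) in le_n.
have markedF A : A \in F -> exists b, A \in marked F b.
  move=> AF; have [b bA dA] := avoidF A AF; exists b.
  by rewrite inE AF bA; apply/forall_inP.
have [starF|] := stability sizeF hd markedF le_n; first by left; split=> //; exact: card_star.
rewrite card_ord => le_F; right.
rewrite lerBrDr -(ler_pM2l (x := (2 * ((2 * 2) ^ d.-1 * d.-1`!))%N%:R)) ?ltr0n //.
rewrite mulrDr mulrA divff ?mul1r ?pnatr_eq0 -?lt0n //.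
by rewrite -natrX -!natrM -natrD ler_nat.
Qed.
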